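(* Let $F:\mathbb R\to\mathbb R$ be a convex differentiable function, $\mathbb P$ a probability measure on $(\Omega,\mathcal F)$, and $\varphi(X)=\int_0^Tf(r,X_r)dr+g(X_T)$. Let $\tilde{\mathbb Q}\in\mathcal P(\Omega)$ be a solution (minimizer) of $$\inf_{\mathbb Q\in\mathcal P(\Omega)}F\left(\mathbb E^{\mathbb Q}[\varphi(X)]\right)+H(\mathbb Q|\mathbb P).$$ Then $\tilde{\mathbb Q}$ is a solution of the linearized problem $$\inf_{\mathbb Q\in\mathcal P(\Omega)}\mathbb E^{\mathbb Q}[\tilde\varphi(X)]+H(\mathbb Q|\mathbb P),\qquad\tilde\varphi(X):=F'\left(\mathbb E^{\tilde{\mathbb Q}}[\varphi(X)]\right)\varphi(X).$$
   Context: $T>0$, $d\ge1$; $\Omega=D([0,T],\mathbb R^d)$ is the space of càdlàg paths with canonical process $X$, $\mathcal F=\sigma(X_r,0\le r\le T)$, and $\mathcal P(\Omega)$ is the set of probability measures on $(\Omega,\mathcal F)$. $f:[0,T]\times\mathbb R^d\to\mathbb R$ and $g:\mathbb R^d\to\mathbb R$ are non-negative Borel functions with $\int_0^Tf(r,X_r)dr<\infty$ $\mathbb P$-a.s. $H(\mathbb Q|\mathbb P)=\mathbb E^{\mathbb Q}[\log\frac{d\mathbb Q}{d\mathbb P}]$ if $\mathbb Q\ll\mathbb P$ and $+\infty$ otherwise. Since $F$ is defined on $\mathbb R$, both infima are understood over those $\mathbb Q$ for which $\mathbb E^{\mathbb Q}[\varphi(X)]$ is well-defined and finite. *)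

(* Defs.v *)
From HB Require Import structures.
From mathcomp Require Import all_boot all_order all_algebra.
From mathcomp Require Import all_classical all_reals all_analysis.
Import Order.TTheory GRing.Theory Num.Theory.
Import numFieldNormedType.Exports.

Set Implicit Arguments.
Unset Strict Implicit.
Unset Printing Implicit Defensive.

Local Open Scope classical_set_scope.
Local Open Scope ring_scope.

Notation Borel E := (g_sigma_algebraType (@open E)).

Section path_space.
Context {R : realType} (d : nat) (T : R).

(* A path on [0, T] is represented by its extension by 0 to the whole line, so
   that two paths are equal in this type iff they agree on [0, T]. *)
Definition is_cadlag (w : R -> 'rV[R]_d) : Prop :=
  [/\ forall t, 0 <= t < T -> w s @[s --> t^'+] --> w t,
      forall t, 0 < t <= T -> cvg (w s @[s --> t^'-]) &
      forall t, ~~ (0 <= t <= T) -> w t = 0].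

Record cadlag : Type := Cadlag {
  path_of :> R -> 'rV[R]_d;
  cadlagP : is_cadlag path_of }.

Lemma is_cadlag0 : is_cadlag (fun=> 0).
Proof.
split=> // t _; first exact: cvg_cst.
exact: is_cvg_cst.
Qed.

HB.instance Definition _ := gen_eqMixin cadlag.
HB.instance Definition _ := gen_choiceMixin cadlag.
HB.instance Definition _ := isPointed.Build cadlag (Cadlag is_cadlag0).

Definition canonical_process (r : R) (w : cadlag) : Borel 'rV[R]_d := w r.

Definition canonical_events : set (set cadlag) :=
  \bigcup_(r in `[0, T])
    preimage_set_system setT (canonical_process r) measurable.

Definition path_space : Type := g_sigma_algebraType canonical_events.

HB.instance Definition _ := Measurable.on path_space.

End path_space.

(* The value is in [0, +oo] since the running cost need not be integrable along
   every path. *)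
Definition path_cost {R : realType} (d : nat) (T : R)
    (f : R * 'rV[R]_d -> R) (g : 'rV[R]_d -> R) (w : path_space d T) : \bar R :=
  (\int[lebesgue_measure]_(r in `[0%R, T]) (f (r, canonical_process r w))%:E
   + (g (canonical_process T w))%:E)%E.

Section entropy.
Context {dsp : measure_display} {Omega : measurableType dsp} {R : realType}.
Local Open Scope ereal_scope.
Local Open Scope charge_scope.

Definition relative_entropy (Q P : probability Omega R) : \bar R :=
  if `[< Q `<< P >]
  then \int[Q]_w lne (('d (charge_of_finite_measure Q) '/d P) w)
  else +oo.

Definition admissible (phi : Omega -> \bar R) : set (probability Omega R) :=
  [set Q | Q.-integrable setT phi].

End entropy.

Definition minimizer {R : realType} {A : Type} (D : set A) (J : A -> \bar R)
  (a : A) : Prop := D a /\ forall b, D b -> (J a <= J b)%E.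

(* Main.v *)
Require Import Defs.
From HB Require Import structures.
From mathcomp Require Import all_boot all_order all_algebra.
From mathcomp Require Import all_classical all_reals all_analysis.
From mathcomp Require Import measurable_realfun ring lra.

(** The theorem is the first-order condition for a minimum along segments of
probability measures. Let [Qt] be the minimizer and [Q] a competitor of finite
entropy, and move from [Qt] towards [Q] along the mixtures
[M t = (1 - t) Qt + t Q]. The expected cost is affine along this segment,
[E_(M t) phi = mt + t (m - mt)], and the relative entropy is convex along it
([relative_entropy_mixture]). Minimality of [Qt] against [M t] thus gives
[F mt + H Qt <= F (mt + t (m - mt)) + (1 - t) H Qt + t H Q], that is,
[H Qt - H Q <= (F (mt + t (m - mt)) - F mt) / t] for [0 < t < 1]. As [t]
decreases to 0 the right-hand side tends to [F' mt * (m - mt)]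
([derivable_cvg_slope_right]), and this is the claimed optimality
[F' mt * mt + H Qt <= F' mt * m + H Q]. A competitor of infinite entropy has
infinite linearized cost; and as soon as one admissible measure has finite
entropy, so has [Qt]. The argument makes sense on any measurable space, and
[linearized_minimizer] states it there; the theorem is its instance for the
path space and the path cost.

The work lies in the convexity of the relative entropy, which is given as the
[Q]-integral of the extended-real function [lne (dQ/dP)], a function without a
sign. The formula [relative_entropy_density] turns it into
[\int[P] kl_fun p] where [p] is any density of [Q] and
[kl_fun x = x ln x - x + 1] is convex and nonnegative: adding [1 - p], which
has [P]-integral 0, leaves the entropy unchanged and makes the integrand
nonnegative. Densities mix like measures, so convexity of the entropy reduces
to that of [kl_fun] under the monotone, additive integral of nonnegative
functions, without any case of the form [+oo - oo]. *)

Set Implicit Arguments.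
Unset Strict Implicit.
Unset Printing Implicit Defensive.

Import Order.TTheory GRing.Theory Num.Theory.
Import numFieldNormedType.Exports.

Local Open Scope classical_set_scope.
Local Open Scope ring_scope.

(** * The integrand of the Kullback-Leibler divergence *)

Section kl_fun.
Context {R : realType}.
Implicit Types x y r t : R.

(** The gap between [x ln x] and its tangent at 1. With [ln 0 = 0] its value at
0 is 1, the continuous extension. *)
Definition kl_fun x : R := x * ln x - x + 1.

(** The tangent inequality at [r] is [ln (r / x) <= r / x - 1] multiplied by
[x]; nonnegativity and convexity of [kl_fun] both follow from it. *)
Lemma kl_fun_tangent x r : 0 <= x -> 0 < r ->
  kl_fun r + ln r * (x - r) <= kl_fun x.
Proof.
move=> x0 r0; rewrite /kl_fun; move: x0; rewrite le_eqVlt => /predU1P[<-|x0].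
  by rewrite (ln0 (lexx 0)); lra.
have : ln (r / x) <= r / x - 1.
  rewrite -[in leLHS](subrKC 1 (r / x)) le_ln1Dx// ltrBrDr addNr.
  exact: divr_gt0.
rewrite ln_div// => /(ler_wpM2l (ltW x0)).
have -> : x * (r / x - 1) = r - x by field; rewrite gt_eqF.
by lra.
Qed.

Lemma kl_fun_ge0 x : 0 <= x -> 0 <= kl_fun x.
Proof.
move=> x0; have := kl_fun_tangent x0 ltr01.
by rewrite /kl_fun !ln1; lra.
Qed.

(** Average the tangent inequalities at the barycenter [r], where the linear
terms cancel. No tangent exists at [r = 0], but then [x = y = 0]. *)
Lemma kl_fun_convex t x y : 0 < t -> t < 1 -> 0 <= x -> 0 <= y ->
  kl_fun ((1 - t) * x + t * y) <= (1 - t) * kl_fun x + t * kl_fun y.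
Proof.
move=> t0 t1 x0 y0; set r := _ + _.
have s0 : 0 < 1 - t by lra.
have : 0 <= r by rewrite addr_ge0// mulr_ge0// ltW.
rewrite le_eqVlt => /predU1P[r0|r0].
  have /eqP : r = 0 by [].
  rewrite paddr_eq0 ?mulr_ge0 ?(ltW s0) ?(ltW t0)// !mulf_eq0.
  rewrite (gt_eqF s0) (gt_eqF t0)/=.
  by move=> /andP[/eqP -> /eqP ->]; rewrite -r0; lra.
have hx := ler_wpM2l (ltW s0) (kl_fun_tangent x0 r0).
have hy := ler_wpM2l (ltW t0) (kl_fun_tangent y0 r0).
have -> : kl_fun r = (1 - t) * (kl_fun r + ln r * (x - r))
    + t * (kl_fun r + ln r * (y - r)).
  by rewrite /r; ring.
exact: lerD.
Qed.

Lemma measurable_kl_fun d (U : measurableType d) (p : U -> R) :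
  measurable_fun setT p -> measurable_fun setT (kl_fun \o p).
Proof.
move=> mp; apply: measurable_funD => //; apply: measurable_funB => //.
by apply: measurable_funM => //; exact: measurableT_comp.
Qed.

End kl_fun.

(** * Two complements on measurability and integration *)

Section extended_logarithm.
Context {R : realType}.
Local Open Scope ereal_scope.

Lemma measurable_lne_fin_num d (U : measurableType d) (p : U -> \bar R) :
  measurable_fun setT p -> (forall x, p x \is a fin_num) ->
  measurable_fun setT (@lne R \o p).
Proof.
move=> mp pfin.
have -> : @lne R \o p = fun x => if (fine (p x) <= 0)%R then -oo
                              else (ln (fine (p x)))%:E.
  by apply/funext => x /=; rewrite -{1}(fineK (pfin x)).
have mfp : measurable_fun setT (fine \o p).
  exact: measurableT_comp.
apply: measurable_fun_ifT => //=.
- by apply: measurable_fun_ler.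
- by apply/measurable_EFinP; exact: (measurableT_comp (@measurable_ln R)).
Qed.

End extended_logarithm.

Section integral_ge0D.
Context d (T : measurableType d) (R : realType) (mu : {measure set T -> \bar R}).
Local Open Scope ereal_scope.

(** Additivity when only one summand is integrable: the other is nonnegative,
so the integral of the sum is still well defined. The identity
[h + u^+ + (h + u)^- = (h + u)^+ + u^-] involves nonnegative terms only, and
the three integrals to be subtracted from it are finite. *)
Lemma integral_ge0D (h u : T -> R) :
  measurable_fun setT h -> (forall x, 0 <= h x)%R ->
  mu.-integrable setT (EFin \o u) ->
  \int[mu]_x (h x + u x)%:E = \int[mu]_x (h x)%:E + \int[mu]_x (u x)%:E.
Proof.
move=> mh h0 iu.
have mu_ : measurable_fun setT u by exact/measurable_EFinP/(measurable_int _ iu).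
pose hu x := (h x + u x)%:E; pose U := EFin \o u.
have mU : measurable_fun setT U by exact/measurable_EFinP.
have mhu : measurable_fun setT hu by exact/measurable_EFinP/measurable_funD.
have mH : measurable_fun setT (EFin \o h) by exact/measurable_EFinP.
have h0E x : 0 <= (EFin \o h) x by rewrite lee_fin.
have pointwise x : (EFin \o h) x + (U^\+ x + hu^\- x) = hu^\+ x + U^\- x.
  rewrite !funeposE !funenegE /hu /U/= -!EFin_max -!EFinD; congr EFin.
  by rewrite /Order.max; do ![case: ifPn]; rewrite -?leNgt; lra.
have Up : \int[mu]_x U^\+ x < +oo by exact: integral_funepos_lt_pinfty.
have Un : \int[mu]_x U^\- x < +oo by exact: integral_funeneg_lt_pinfty.
have hun : \int[mu]_x hu^\- x < +oo.
  apply: le_lt_trans Un; apply: ge0_le_integral => //.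
  - exact: measurable_funeneg.
  - exact: measurable_funeneg.
  - move=> x _; rewrite !funenegE /hu /U/= -!EFin_max lee_fin.
    have := h0 x; rewrite /Order.max.
    by do ![case: ifPn]; rewrite -?leNgt; lra.
have := congr1 (fun k => \int[mu]_x k x) (funext pointwise).
rewrite [X in X = _]ge0_integralD//; last 2 first.
- by move=> x _; rewrite adde_ge0.
- by apply: emeasurable_funD; [exact: measurable_funepos|exact: measurable_funeneg].
rewrite [X in _ + X = _]ge0_integralD//; last 2 first.
- exact: measurable_funepos.
- exact: measurable_funeneg.
rewrite [X in _ = X]ge0_integralD//; last 2 first.
- exact: measurable_funepos.
- exact: measurable_funeneg.
rewrite [in X in _ -> X = _]integralE [X in _ -> _ = _ + X]integralE.
move: Up Un hun.
have : 0 <= \int[mu]_x U^\+ x by exact: integral_ge0.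
have : 0 <= \int[mu]_x U^\- x by exact: integral_ge0.
have : 0 <= \int[mu]_x hu^\- x by exact: integral_ge0.
have : 0 <= \int[mu]_x hu^\+ x by exact: integral_ge0.
have : 0 <= \int[mu]_x (EFin \o h) x by exact: integral_ge0.
rewrite -/U -/hu.
move: (\int[mu]_x U^\+ x) (\int[mu]_x U^\- x) (\int[mu]_x hu^\- x)
  (\int[mu]_x hu^\+ x) (\int[mu]_x (EFin \o h) x).
move=> [c| |] [e| |] [b| |] [a| |] [k| |] //= _ _ _ _ _ _ _ _ [] ?.
by congr EFin; lra.
Qed.

End integral_ge0D.

(** * Relative entropy in terms of a density *)

Section entropy.
Context {d} {T : measurableType d} {R : realType}.
Implicit Types Q P : probability T R.
Local Open Scope ereal_scope.
Local Open Scope charge_scope.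

Definition density Q P (p : T -> R) : Prop :=
  [/\ measurable_fun setT p, forall x, (0 <= p x)%R &
      forall A, measurable A -> Q A = \int[P]_(x in A) (p x)%:E].

Lemma density_integrable Q P p : density Q P p -> P.-integrable setT (EFin \o p).
Proof.
move=> [mp p0 Qp]; apply/integrableP; split; first exact/measurable_EFinP.
under eq_integral do rewrite /= ger0_norm//.
by rewrite -Qp// probability_setT ltry.
Qed.

Lemma density_dominates Q P p : density Q P p -> Q `<< P.
Proof.
move=> [mp p0 Qp]; apply/null_content_dominatesP => A mA PA.
rewrite Qp//; apply: null_set_integral => //.
exact/measurable_funTS/measurable_EFinP.
Qed.

Lemma density_fine_RN Q P : Q `<< P ->
  density Q P (fine \o Radon_Nikodym_SigmaFinite.f Q P).
Proof.
move=> QP; split.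
- apply: measurableT_comp => //.
  exact: measurable_int (Radon_Nikodym_SigmaFinite.f_integrable QP).
- by move=> x /=; exact/fine_ge0/Radon_Nikodym_SigmaFinite.f_ge0.
- move=> A mA; rewrite (Radon_Nikodym_SigmaFinite.f_integral QP)//.
  apply: eq_integral => x _ /=.
  by rewrite fineK// Radon_Nikodym_SigmaFinite.f_fin_num.
Qed.

Lemma density_ae_eq Q P p q : density Q P p -> density Q P q ->
  ae_eq P setT (EFin \o p) (EFin \o q).
Proof.
move=> pP [mq q0 Qq]; have [mp p0 Qp] := pP.
apply: integral_ae_eq => //.
- exact: density_integrable pP.
- exact/measurable_EFinP.
- by move=> E _ mE; rewrite -Qp// -Qq.
Qed.

(** The change of variables is applied to the positive and negative parts
separately, since [ln p] need not be [Q]-integrable. *)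
Lemma integral_ln_RN Q P : Q `<< P ->
  let p := fine \o Radon_Nikodym_SigmaFinite.f Q P in
  \int[Q]_x (ln (p x))%:E = \int[P]_x (p x * ln (p x))%:E.
Proof.
move=> QP p; have [mp p0 Qp] := density_fine_RN QP.
have mln : measurable_fun setT (EFin \o (@ln R) \o p).
  by apply/measurable_EFinP; exact: (measurableT_comp (@measurable_ln R)).
have ch (k : T -> \bar R) : measurable_fun setT k -> (forall x, 0 <= k x) ->
    \int[Q]_x k x = \int[P]_x (k x * (p x)%:E).
  move=> mk k0; rewrite -(Radon_Nikodym_SigmaFinite.change_of_variables QP)//.
  apply: eq_integral => x _; rewrite /p/= fineK//.
  exact: Radon_Nikodym_SigmaFinite.f_fin_num.
rewrite integralE [RHS]integralE; congr (_ - _).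
- rewrite ch//; last exact: measurable_funepos.
  apply: eq_integral => x _.
  by rewrite !funeposE/= muleC EFinM
     -[X in _ = maxe _ X](mule0 (p x)%:E) maxe_pMr ?lee_fin.
- rewrite ch//; last exact: measurable_funeneg.
  apply: eq_integral => x _.
  by rewrite !funenegE/= muleC -mulrN EFinM
     -[X in _ = maxe _ X](mule0 (p x)%:E) maxe_pMr ?lee_fin.
Qed.

(** This lets [lne p], which is [-oo] where [p] vanishes, be replaced by the
real-valued [ln p] under [Q]. *)
Lemma ae_gt0_density Q P p : density Q P p -> {ae Q, forall x, (0 < p x)%R}.
Proof.
move=> [mp p0 Qp].
have mA : measurable [set x | p x = 0%R].
  by rewrite -[X in measurable X]setTI; exact: (mp measurableT [set 0%R]).
exists [set x | p x = 0%R]; split => //.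
- rewrite Qp//; apply: integral0_eq => x /= ->//.
- move=> x /= /negP; rewrite -leNgt => px; apply/eqP; rewrite eq_le px; exact: p0.
Qed.

(** [\int[Q] ln p = \int[P] p ln p] and [p ln p = kl_fun p + (p - 1)], where
[p - 1] has [P]-integral [Q setT - 1 = 0]. *)
Lemma relative_entropy_density Q P p : density Q P p ->
  relative_entropy Q P = \int[P]_x (kl_fun (p x))%:E.
Proof.
move=> dp; have QP := density_dominates dp.
rewrite /relative_entropy asboolT//.
set q := fine \o Radon_Nikodym_SigmaFinite.f Q P.
have dq : density Q P q := density_fine_RN QP.
have [[mp p0 _] [mq q0 _]] := (dp, dq).
(* A density is unique up to a [P]-null set, so [q] can stand for [p]. *)
transitivity (\int[P]_x (kl_fun (q x))%:E); last first.
  apply: ae_eq_integral => //.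
  - by apply/measurable_EFinP; exact: measurable_kl_fun.
  - by apply/measurable_EFinP; exact: measurable_kl_fun.
  - have := density_ae_eq dq dp.
    by apply: filterS => x /= qp _; have [->] := qp I.
transitivity (\int[Q]_x (ln (q x))%:E).
  have mRN : measurable_fun setT ('d (charge_of_finite_measure Q) '/d P).
    by apply: measurable_int; exact: Radon_Nikodym_integrable.
  have RNfin x : ('d (charge_of_finite_measure Q) '/d P) x \is a fin_num.
    exact: Radon_Nikodym_fin_num.
  apply: ae_eq_integral => //.
  - exact: measurable_lne_fin_num.
  - by apply/measurable_EFinP; exact: (measurableT_comp (@measurable_ln R)).
  - have := null_dominates_ae_eq measurableT QP
      (ae_eq_Radon_Nikodym_SigmaFinite QP measurableT).
    have := ae_gt0_density dq.
    apply: filterS2 => x qx0 /= /(_ I) <- _.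
    rewrite -lne_EFin//; congr lne; rewrite /q [RHS]fineK//.
    exact: Radon_Nikodym_SigmaFinite.f_fin_num.
rewrite integral_ln_RN// -/q.
have iq1 : P.-integrable setT (EFin \o (fun x => q x - 1)%R).
  rewrite (_ : _ \o _ = (EFin \o q) \- cst 1)//.
  apply: integrableB => //; first exact: density_integrable dq.
  exact: finite_measure_integrable_cst.
rewrite (_ : (fun x => _) = fun x => (kl_fun (q x) + (q x - 1))%:E); last first.
  by apply/funext => x; rewrite /kl_fun; congr EFin; lra.
rewrite integral_ge0D//; last 2 first.
  exact: measurable_kl_fun.
  by move=> x; exact: kl_fun_ge0.
rewrite (_ : \int[P]_x (q x - 1)%:E = 0) ?adde0//.
under eq_integral do rewrite EFinB.
rewrite integralB//; last 2 first.
  exact: density_integrable dq.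
  exact: finite_measure_integrable_cst.
have [_ _ <-//] := dq.
rewrite probability_setT integral_cst// mul1e.
by rewrite [X in _ - X](probability_setT P : _ = 1) subee.
Qed.

Lemma relative_entropy_ge0 Q P : 0 <= relative_entropy Q P.
Proof.
have [QP|nQP] := pselect (Q `<< P); last by rewrite /relative_entropy asboolF.
rewrite (relative_entropy_density (density_fine_RN QP)).
apply: integral_ge0 => x _; rewrite lee_fin kl_fun_ge0//.
by have [] := density_fine_RN QP.
Qed.

Lemma relative_entropy_lty_dominates Q P : relative_entropy Q P < +oo -> Q `<< P.
Proof. by rewrite /relative_entropy; case: asboolP => //; rewrite ltxx. Qed.

End entropy.

(** * Mixtures of two probability measures *)

Section mixture.
Context {d} {T : measurableType d} {R : realType}.
Variables (Q0 Q1 : probability T R) (t : R) (t0 : 0 <= t) (t1 : t <= 1).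
Local Open Scope ereal_scope.

Let s0 : (0 <= 1 - t)%R. Proof. by rewrite subr_ge0. Qed.

Definition mixture : set T -> \bar R :=
  measure_add (mscale (NngNum s0) Q0) (mscale (NngNum t0) Q1).

HB.instance Definition _ := Measure.on mixture.

Lemma mixtureE A : mixture A = (1 - t)%:E * Q0 A + t%:E * Q1 A.
Proof. by rewrite /mixture measure_addE. Qed.

Let mixture_setT : mixture setT = 1.
Proof. by rewrite mixtureE !probability_setT !mule1 -EFinD subrK. Qed.

HB.instance Definition _ :=
  @Measure_isProbability.Build _ _ _ mixture mixture_setT.

Lemma ge0_integral_mixture (f : T -> \bar R) :
  measurable_fun setT f -> (forall x, 0 <= f x) ->
  \int[mixture]_x f x =
    (1 - t)%:E * \int[Q0]_x f x + t%:E * \int[Q1]_x f x.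
Proof. by move=> mf f0; rewrite ge0_integral_measure_add// !ge0_integral_mscale. Qed.

Lemma integrable_mixture (f : T -> \bar R) :
  Q0.-integrable setT f -> Q1.-integrable setT f ->
  mixture.-integrable setT f.
Proof.
move=> /integrableP[mf f0] /integrableP[_ f1]; apply/integrableP; split => //.
rewrite ge0_integral_mixture//; last exact: measurableT_comp.
by rewrite lte_add_pinfty// lte_mul_pinfty// lee_fin.
Qed.

Lemma integral_mixture (f : T -> \bar R) :
  Q0.-integrable setT f -> Q1.-integrable setT f ->
  \int[mixture]_x f x =
    (1 - t)%:E * \int[Q0]_x f x + t%:E * \int[Q1]_x f x.
Proof.
move=> f0 f1; have [mf _] := integrableP _ _ _ f0.
rewrite integralE (integralE Q0) (integralE Q1).
rewrite !ge0_integral_mixture//;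
  [|exact: measurable_funeneg|exact: measurable_funepos].
have /fineK <- : \int[Q0]_x f^\+ x \is a fin_num.
  by rewrite integrable_pos_fin_num.
have /fineK <- : \int[Q1]_x f^\+ x \is a fin_num.
  by rewrite integrable_pos_fin_num.
have /fineK <- : \int[Q0]_x f^\- x \is a fin_num.
  by rewrite integrable_neg_fin_num.
have /fineK <- : \int[Q1]_x f^\- x \is a fin_num.
  by rewrite integrable_neg_fin_num.
by rewrite -!EFinM -!EFinD; congr EFin; ring.
Qed.

Lemma density_mixture (P : probability T R) p0 p1 :
  density Q0 P p0 -> density Q1 P p1 ->
  density mixture P (fun x => (1 - t) * p0 x + t * p1 x)%R.
Proof.
move=> [mp0 p0_ge0 Qp0] [mp1 p1_ge0 Qp1]; split.
- by apply: measurable_funD; apply: measurable_funM.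
- by move=> x; rewrite addr_ge0// mulr_ge0.
- move=> A mA; rewrite [LHS](mixtureE A) Qp0// Qp1//.
  under [RHS]eq_integral do rewrite EFinD !EFinM.
  have mp0A : measurable_fun A (EFin \o p0).
    exact/measurable_funTS/measurable_EFinP.
  have mp1A : measurable_fun A (EFin \o p1).
    exact/measurable_funTS/measurable_EFinP.
  rewrite ge0_integralD//; last 4 first.
  + by move=> x _; rewrite -EFinM lee_fin mulr_ge0.
  + exact: measurable_funeM.
  + by move=> x _; rewrite -EFinM lee_fin mulr_ge0.
  + exact: measurable_funeM.
  by rewrite !ge0_integralZl_EFin// => x _; rewrite lee_fin.
Qed.

(** Pointwise convexity of [kl_fun] at the two densities, integrated. *)
Lemma relative_entropy_mixture (P : probability T R) :
  (0 < t < 1)%R -> Q0 `<< P -> Q1 `<< P ->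
  relative_entropy mixture P <=
    (1 - t)%:E * relative_entropy Q0 P + t%:E * relative_entropy Q1 P.
Proof.
move=> /andP[t_gt0 t_lt1] Q0P Q1P.
have dQ0 := density_fine_RN Q0P; have dQ1 := density_fine_RN Q1P.
rewrite (relative_entropy_density (density_mixture dQ0 dQ1)).
rewrite (relative_entropy_density dQ0) (relative_entropy_density dQ1).
move: (fine \o _) (fine \o _) dQ0 dQ1 => p0 p1 dQ0 dQ1.
have [[mp0 p0_ge0 _] [mp1 p1_ge0 _]] := (dQ0, dQ1).
have [mp p_ge0 _] := density_mixture dQ0 dQ1.
have mk0 : measurable_fun setT (EFin \o (kl_fun \o p0)).
  by apply/measurable_EFinP; exact: measurable_kl_fun.
have mk1 : measurable_fun setT (EFin \o (kl_fun \o p1)).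
  by apply/measurable_EFinP; exact: measurable_kl_fun.
rewrite -!ge0_integralZl_EFin//; last 2 first.
- by move=> x _; rewrite lee_fin kl_fun_ge0.
- by move=> x _; rewrite lee_fin kl_fun_ge0.
rewrite -ge0_integralD//; last 4 first.
- by move=> x _; rewrite -EFinM lee_fin mulr_ge0// kl_fun_ge0.
- exact: measurable_funeM.
- by move=> x _; rewrite -EFinM lee_fin mulr_ge0// kl_fun_ge0.
- exact: measurable_funeM.
apply: ge0_le_integral => //.
- by move=> x _; rewrite lee_fin kl_fun_ge0.
- by apply/measurable_EFinP; exact: measurable_kl_fun.
- by apply: emeasurable_funD; exact: measurable_funeM.
- by move=> x _; rewrite -!EFinM -EFinD lee_fin kl_fun_convex.
Qed.

End mixture.

(** * First-order condition *)

Section first_order.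
Context {R : realType}.

(** One-sided, because mixtures with weight [t] exist for [0 <= t <= 1] only. *)
Lemma derivable_cvg_slope_right (F : R -> R) (a v : R) : derivable F a 1 ->
  t^-1 * (F (a + t * v) - F a) @[t --> 0^'+] --> derive1 F a * v.
Proof.
move=> Fa.
have dF : differentiable F a by exact/derivable1_diffP.
have -> : derive1 F a * v = 'D_v F a.
  by rewrite deriveE// deriv1E// mulrC.
have : derivable F a v by exact: diff_derivable.
move=> /cvg_dnbhs_at_right; apply: cvg_trans; apply: near_eq_cvg.
by near=> t; rewrite /= [t *: v + a]addrC.
Unshelve. all: by end_near. Qed.

End first_order.

Section linearization.
Context {d} {T : measurableType d} {R : realType}.
Local Open Scope ereal_scope.

(** Compare [Qt] with the mixtures [(1 - t) Qt + t Q] and let [t] tend to 0. *)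
Lemma linearized_minimizer (P Qt : probability T R) (phi : T -> \bar R)
    (F : R -> R) :
  derivable F (fine (\int[Qt]_x phi x)) 1 ->
  minimizer (admissible phi)
    (fun Q => (F (fine (\int[Q]_x phi x)))%:E + relative_entropy Q P) Qt ->
  minimizer (admissible phi)
    (fun Q => \int[Q]_x ((derive1 F (fine (\int[Qt]_y phi y)))%:E * phi x)
              + relative_entropy Q P) Qt.
Proof.
set mt := fine _ => F_diff [Qt_adm Qt_min]; split=> // Q Q_adm.
rewrite !integralZl//.
rewrite -(fineK (integrable_fin_num _ Qt_adm))// -/mt.
rewrite -(fineK (integrable_fin_num _ Q_adm))//.
(* A competitor of infinite entropy has infinite linearized cost. *)
have [HQ|] := ltP (relative_entropy Q P) +oo; last first.
  by rewrite leye_eq => /eqP ->; rewrite -EFinM addey// leey.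
have Hfin (Q' : probability T R) : relative_entropy Q' P < +oo ->
    relative_entropy Q' P \is a fin_num.
  by move=> HQ'; rewrite ge0_fin_numE ?relative_entropy_ge0.
(* The finite cost of [Q] bounds that of [Qt]. *)
have HQt : relative_entropy Qt P < +oo.
  have := Qt_min _ Q_adm; rewrite -(fineK (Hfin _ HQ)) -EFinD.
  by case: (relative_entropy Qt P) => [r||]//=; rewrite ltry.
have QP := relative_entropy_lty_dominates HQ.
have QtP := relative_entropy_lty_dominates HQt.
set m := fine (\int[Q]_x phi x).
pose h := fine (relative_entropy Q P); pose ht := fine (relative_entropy Qt P).
have hE : relative_entropy Q P = h%:E by rewrite fineK ?Hfin.
have htE : relative_entropy Qt P = ht%:E by rewrite fineK ?Hfin.
have step (t : R) : (0 < t < 1)%R ->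
    (ht - h <= t^-1 * (F (mt + t * (m - mt)) - F mt))%R.
  move=> t01; have /andP[t_gt0 t_lt1] := t01.
  pose M : probability T R := mixture Qt Q (ltW t_gt0) (ltW t_lt1).
  have M_adm : admissible phi M by exact: integrable_mixture.
  have := Qt_min _ M_adm.
  have -> : fine (\int[M]_x phi x) = (mt + t * (m - mt))%R.
    rewrite integral_mixture//.
    rewrite -(fineK (integrable_fin_num _ Qt_adm))// -/mt.
    rewrite -(fineK (integrable_fin_num _ Q_adm))// -/m.
    by rewrite -!EFinM -EFinD /=; ring.
  move=> /le_trans/(_ (leeD2l _ (relative_entropy_mixture _ _ t01 QtP QP))).
  rewrite hE htE -!EFinM -!EFinD lee_fin => ineq.
  rewrite ler_pdivlMl//; lra.
have first_order : (ht - h <= derive1 F mt * (m - mt))%R.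
  apply: (cvgr_to_ge (derivable_cvg_slope_right F_diff)).
  have := nbhs_right_lt (@ltr01 R); have := nbhs_right_gt (0 : R).
  by apply: filterS2 => t t_gt0 t_lt1; apply: step; rewrite t_gt0.
by rewrite hE htE -!EFinM -!EFinD lee_fin; lra.
Qed.

End linearization.

Theorem lemmaE1 (R : realType) (d : nat) (T : R)
  (f : R * 'rV[R]_d -> R) (g : 'rV[R]_d -> R) (F : R -> R)
  (P Qt : probability (path_space d T) R)
  (d_gt0 : (0 < d)%N) (T_gt0 : 0 < T)
  (mf : measurable_fun (`[0, T] `*` setT : set (Borel (R * 'rV[R]_d)%type)) f)
  (f_ge0 : forall (r : R) (x : 'rV[R]_d), 0 <= r <= T -> 0 <= f (r, x))
  (mg : measurable_fun (setT : set (Borel 'rV[R]_d)) g)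
  (g_ge0 : forall x, 0 <= g x)
  (f_fin : {ae P, forall w : path_space d T,
     (\int[lebesgue_measure]_(r in `[0%R, T]) (f (r, canonical_process r w))%:E
        < +oo)%E})
  (F_convex : convex_function [set: R^o] F)
  (F_diff : forall x : R, derivable F x 1)
  (Qt_min : minimizer (admissible (path_cost f g))
     (fun Q => ((F (fine (\int[Q]_w path_cost f g w)))%:E
                + relative_entropy Q P)%E) Qt) :
  minimizer (admissible (path_cost f g))
    (fun Q => (\int[Q]_w
         ((derive1 F (fine (\int[Qt]_v path_cost f g v)))%:E * path_cost f g w)
       + relative_entropy Q P)%E) Qt.
Proof.
exact: linearized_minimizer (F_diff _) Qt_min.
Qed.
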